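(* Let $\phi:\mathscr K^1\to\mathbb R$ be an arbitrary valuation. Then there exist two unique functions $f,g:\mathbb R\to\mathbb R$ with $f(0)=0$ such that $\phi([a,b])=g(b)-f(a)$ for all real $a\le b$. Conversely, any pair of functions $f,g:\mathbb R\to\mathbb R$ with $f(0)=0$ defines a valuation by this formula (together with $\phi(\emptyset)=0$). Moreover, with $f,g$ the functions associated with $\phi$: (i) $\phi$ is integer-valued if and only if $f$ and $g$ are integer-valued; (ii) $\phi$ is monotone if and only if $f$ and $g$ are non-decreasing and $f\le g$; (iii) $\phi$ is $\sigma$-continuous if and only if $f$ is left-continuous and $g$ is right-continuous; (iv) $\phi$ is integer-valued and monotone if and only if there exist $N_1,N_2,N_3\in\mathbb N\cup\{0,\infty\}$, a locally finite family of $N_1$ intervals $\langle\!\langle p_n,q_n\rangle\!\rangle$, and two locally finite families of $N_2$ points $r_n\in\mathbb R$ and $N_3$ points $s_n\in\mathbb R$, respectively (repetitions allowed), such that for all real $a\le b$ $$\phi([a,b])=\sum_{n=1}^{N_1}\mathbf 1\bigl\{[a,b]\cap\langle\!\langle p_n,q_n\rangle\!\rangle\neq\emptyset\bigr\}+\sum_{n=1}^{N_2}\mathbf 1\{r_n\in(a,b]\}+\sum_{n=1}^{N_3}\mathbf 1\{s_n\in[a,b)\};$$ (v) $\phi$ is integer-valued, monotone and $\sigma$-continuous if and only if there exist $N\in\mathbb N\cup\{0,\infty\}$ and a locally finite family of $N$ closed intervals $[p_n,q_n]$ such that for all real $a\le b$ $$\phi([a,b])=\sum_{n=1}^{N}\mathbf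 1\bigl\{[a,b]\cap[p_n,q_n]\neq\emptyset\bigr\}.$$
   Context: $\mathscr K^1$ is the family of all compact intervals $[a,b]$, $a\le b$ real, together with the empty set. A valuation is a map $\phi$ on $\mathscr K^1$ with $\phi(\emptyset)=0$ and $\phi(K\cup L)+\phi(K\cap L)=\phi(K)+\phi(L)$ for all $K,L\in\mathscr K^1$ such that $K\cup L$ is convex. It is monotone if $\phi(K)\le\phi(L)$ whenever $K\subset L$ (in particular, $\phi\ge\phi(\emptyset)=0$). It is $\sigma$-continuous if $\phi(K_n)\to\phi(K)$ for every sequence $(K_n)$ in $\mathscr K^1$ with $K_n\downarrow K$ (decreasing with intersection $K$). For $-\infty\le p\le q\le\infty$, $\langle\!\langle p,q\rangle\!\rangle$ denotes any of the four types of interval with endpoints $p,q$: closed, open, or half-open on either side. If $p=-\infty$ or $q=\infty$, the interval is open on the corresponding side. If $p=q$ (which is then a real number), $\langle\!\langle p,q\rangle\!\rangle=\{p\}$. The same convention at infinite endpoints applies to the closed intervals in (v), i.e. $[p_n,q_n]$ is a nonempty closed subinterval of $\mathbb R$, possibly unbounded. A family of intervals (repetitions allowed) is locally finite if only finitely many of its members meet any given compact interval; a family of points is locally finite if only finitely many of its members (counted with repetitions) lie in any given compact interval. *)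

(* Defs.v *)
From HB Require Import structures.
From mathcomp Require Import all_boot all_order all_algebra.
From mathcomp Require Import all_classical all_reals all_analysis.

Set Implicit Arguments.
Unset Strict Implicit.
Unset Printing Implicit Defensive.

Import Order.TTheory GRing.Theory Num.Theory numFieldNormedType.Exports.

Local Open Scope classical_set_scope.
Local Open Scope ring_scope.

Definition K1 (R : realType) : set (set R) :=
  [set K | K = set0 \/ exists a b : R, a <= b /\ K = `[a, b]%classic].

(* A map on K1 is represented by a total function [set R -> R] whose values
   outside K1 are irrelevant: every property below only looks at members of
   K1 (the intersection of two members of K1 is in K1, and so is their union
   when it is convex). *)
Definition valuation (R : realType) (phi : set R -> R) : Prop :=
  phi set0 = 0 /\
  forall K L : set R, K1 K -> K1 L -> @convex_set R R^o (K `|` L) ->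
    phi (K `|` L) + phi (K `&` L) = phi K + phi L.

Definition integer_valued (R : realType) (phi : set R -> R) : Prop :=
  forall K : set R, K1 K -> phi K \is a Num.int.

Definition monotone_valuation (R : realType) (phi : set R -> R) : Prop :=
  forall K L : set R, K1 K -> K1 L -> K `<=` L -> phi K <= phi L.

Definition sigma_continuous (R : realType) (phi : set R -> R) : Prop :=
  forall (K_ : nat -> set R) (K : set R),
    (forall n, K1 (K_ n)) -> K1 K ->
    (forall m n, (m <= n)%N -> K_ n `<=` K_ m) ->
    \bigcap_n K_ n = K ->
    phi (K_ n) @[n --> \oo] --> phi K.

Definition represents (R : realType) (f g : R -> R)
    (phi : set R -> R) : Prop :=
  forall a b : R, a <= b -> phi `[a, b]%classic = g b - f a.

Definition left_continuous_fun (R : realType) (f : R -> R) : Prop :=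
  forall x : R, f @ x^'- --> f x.

Definition right_continuous_fun (R : realType) (f : R -> R) : Prop :=
  forall x : R, f @ x^'+ --> f x.

(* A cardinality in {0, 1, 2, ...} or infinity, [None] being infinity;
   a family of N members is indexed by the naturals smaller than N. *)
Definition index_set (N : option nat) : set nat :=
  if N is Some n then `I_n else setT.

(* [p, q], (p, q), [p, q) or (p, q], closed on the left iff [cl] and on the
   right iff [cr]; it is {p} when p = q.  As it only contains real numbers,
   [cl] and [cr] are irrelevant at infinite endpoints. *)
Definition ext_itv (R : realType) (cl cr : bool) (p q : \bar R) : set R :=
  if p == q then [set x : R | x%:E = p]
  else [set x : R | x%:E \in Interval (BSide cl p) (BSide (~~ cr) q)].

Definition itv_endpoints (R : realType) (p q : \bar R) : Prop :=
  (p <= q)%E /\ (p = q -> p \is a fin_num).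

Definition locally_finite_itvs (R : realType) (N : option nat)
    (J : nat -> set R) : Prop :=
  forall a b : R, a <= b ->
    finite_set [set n | index_set N n /\ `[a, b] `&` J n !=set0].

Definition locally_finite_points (R : realType) (N : option nat)
    (r : nat -> R) : Prop :=
  forall a b : R, a <= b ->
    finite_set [set n | index_set N n /\ r n \in `[a, b]].

(* In the three sums below only finitely many terms are nonzero when the
   family is locally finite, so the finitely supported sum of the library is
   the actual sum of the possibly infinite series. *)
Definition hitting_sum (R : realType) (N : option nat) (J : nat -> set R)
    (a b : R) : R :=
  \sum_(n \in index_set N) ((`[< `[a, b] `&` J n !=set0 >])%:R : R).

Definition oc_sum (R : realType) (N : option nat) (r : nat -> R)
    (a b : R) : R :=
  \sum_(n \in index_set N) ((r n \in `]a, b])%:R : R).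

Definition co_sum (R : realType) (N : option nat) (s : nat -> R)
    (a b : R) : R :=
  \sum_(n \in index_set N) ((s n \in `[a, b[)%:R : R).

(* Main.v *)
Require Import Defs.
From HB Require Import structures.
From mathcomp Require Import all_boot all_order all_algebra.
From mathcomp Require Import all_classical all_reals all_analysis.
From mathcomp Require Import ring lra zify.

Set Implicit Arguments.
Unset Strict Implicit.
Unset Printing Implicit Defensive.

Import Order.TTheory GRing.Theory Num.Theory numFieldNormedType.Exports.

Local Open Scope classical_set_scope.
Local Open Scope ring_scope.

(* A valuation on segments satisfies F(a,d) + F(b,c) = F(a,c) + F(b,d) for
   a <= b <= c <= d, hence splits as F(a,b) = g(b) - f(a).

   For (iv), g(b) - f(a) counts the integers k with f(a) < k <= g(b), that is,
   with b in V_k := {g >= k} and a not in U_k := {f >= k}.  These are up-sets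
   with U_k included in V_k.  If U_k <> V_k, the condition says that [a,b] hits
   the interval V_k \ U_k; if U_k = V_k is [w,oo) or (w,oo), it says w in (a,b]
   or w in [a,b) respectively; if U_k = V_k is empty or the whole line, it never
   holds.  For (v), one-sided continuity makes V_k closed and U_k open, so that
   V_k \ U_k is closed and U_k = V_k only in the trivial cases. *)

(** * Representation of a valuation by a pair of functions; integrality and monotonicity *)

Section representation.
Context (R : realType).
Implicit Types (phi : set R -> R) (f g : R -> R).

Lemma K1_segment (a b : R) : a <= b -> K1 `[a, b]%classic.
Proof. by move=> ab; right; exists a, b. Qed.

Lemma convex_segment (a b : R) : @convex_set R R^o `[a, b]%classic.
Proof.
move=> x y t; rewrite !inE/= !in_itv/= => /andP[ax xb] /andP[ay yb].
have t0 : 0 <= t%:num by [].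
have t1 : t%:num <= 1 by [].
rewrite (_ : conv t x y = t%:num * x + (1 - t%:num) * y)//.
by apply/andP; split; nra.
Qed.

Lemma subset_segmentP (a b c d : R) : a <= b ->
  `[a, b]%classic `<=` `[c, d]%classic <-> c <= a /\ b <= d.
Proof.
move=> ab; split=> [sub|[ca bd] x /=]; last first.
  by rewrite !in_itv/= => /andP[ax xb]; apply/andP; split; lra.
have /sub/= : `[a, b]%classic a by rewrite /= in_itv/= lexx.
have /sub/= : `[a, b]%classic b by rewrite /= in_itv/= lexx andbT.
by rewrite !in_itv/= => /andP[_ ->] /andP[-> _].
Qed.

(** As b <= c, the segments [a,c] and [b,d] overlap in [b,c] and their union [a,d] is convex, so the
    valuation property applies to them. *)
Lemma valuation_segments phi (a b c d : R) : valuation phi ->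
  a <= b -> b <= c -> c <= d ->
  phi `[a, d]%classic + phi `[b, c]%classic =
  phi `[a, c]%classic + phi `[b, d]%classic.
Proof.
move=> [_ val] ab bc cd.
have unionE : `[a, c]%classic `|` `[b, d]%classic = `[a, d]%classic :> set R.
  apply/seteqP; split=> x /=; rewrite !in_itv/=.
    by move=> [] /andP[? ?]; apply/andP; split; lra.
  move=> /andP[ax xd]; have [xc|cx] := leP x c; first by left; rewrite ax.
  by right; rewrite xd andbT; lra.
have interE : `[a, c]%classic `&` `[b, d]%classic = `[b, c]%classic :> set R.
  apply/seteqP; split=> x /=; rewrite !in_itv/=.
    by move=> [/andP[? ?] /andP[? ?]]; apply/andP; split; lra.
  by move=> /andP[? ?]; split; apply/andP; split; lra.
rewrite -unionE -interE; apply: val; try by apply: K1_segment; lra.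
by rewrite unionE; exact: convex_segment.
Qed.

Lemma representation_exists phi : valuation phi ->
  exists f g : R -> R, f 0 = 0 /\ represents f g phi.
Proof.
move=> val; pose F a b := phi `[a, b]%classic.
have FE a b c d : a <= b -> b <= c -> c <= d -> F a d + F b c = F a c + F b d.
  exact: valuation_segments val.
(* Both formulas are forced by f(0) = 0: g(b) = F(0,b) for b >= 0 and f(a) = F(0,0) - F(a,0) for a
   <= 0, while F(x,x) = g(x) - f(x) gives the remaining half of each function. The minimum and the
   maximum merge the two halves. *)
pose g b := F (Num.min b 0) b - F (Num.min b 0) 0 + F 0 0.
pose f a := g (Num.max a 0) - F a (Num.max a 0).
exists f, g; split.
  by rewrite /f /g maxxx minxx; ring.
move=> a b ab; rewrite -/(F a b) /f /g.
have [a0|a0] := leP a 0; have [b0|b0] := leP b 0; rewrite ?minxx.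
- by have := FE a b b 0 ab (lexx b) b0; lra.
- by have := FE a 0 0 b a0 (lexx 0) (ltW b0); lra.
- lra.
- by have := FE 0 a a b (ltW a0) (lexx a) ab; case: ltgtP; lra.
Qed.

(** With f(0) = 0, the segments [0,x] determine g on the right of 0 and the segments [x,0] determine
    f on the left; the degenerate segments [x,x] pass from one function to the other. *)
Lemma representation_unique phi f g f' g' : f 0 = 0 -> f' 0 = 0 ->
  represents f g phi -> represents f' g' phi -> f = f' /\ g = g'.
Proof.
move=> f0 f'0 repr repr'.
have E a b (ab : a <= b) : g b - f a = g' b - f' a by rewrite -repr// -repr'.
suff gE x : g x = g' x.
  by split; apply/funext => x; have := E x x (lexx x); rewrite ?gE//; lra.
have [x0|x0] := leP 0 x; first by have := E 0 x x0; lra.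
by have := E x x (lexx x); have := E x 0 (ltW x0); have := E 0 0 (lexx 0); lra.
Qed.

(** Convexity of the union forces two nonempty segments to meet. Union and intersection are then
    segments whose endpoints are minima and maxima of the given ones, and the terms in [f] and in
    [g] balance separately. *)
Lemma represents_valuation phi f g :
  phi set0 = 0 -> represents f g phi -> valuation phi.
Proof.
move=> phi0 repr; split=> // K L.
move=> [->|[a [b [ab ->]]]]; first by rewrite !set0U set0I phi0 addrC.
move=> [->|[c [d [cd ->]]]]; first by rewrite setU0 setI0 phi0.
move=> conv.
have ina (x y : R) : x <= y -> `[x, y]%classic x by move=> ?; rewrite /= in_itv/= lexx.
have inb (x y : R) : x <= y -> `[x, y]%classic y.
  by move=> ?; rewrite /= in_itv/= lexx andbT.
(* Midpoint convexity suffices: the midpoint of a gap between the segments would belong to neither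
   of them. *)
have mid x y : (`[a, b] `|` `[c, d]) x -> (`[a, b] `|` `[c, d]) y ->
    (`[a, b] `|` `[c, d]) ((x + y) / 2).
  have h0 : (0 : R) <= 2^-1 by rewrite invr_ge0.
  have h1 : (2^-1 : R) <= 1 by rewrite invf_le1 ?ler1n.
  move=> /mem_set Ax /mem_set Ay; have := conv x y (Itv01 h0 h1) Ax Ay.
  rewrite inE => Axy.
  suff -> : (x + y) / 2 = 2^-1 * x + (1 - 2^-1) * y by exact: Axy.
  by field.
have cb : c <= b.
  rewrite leNgt; apply/negP => bc.
  have := mid b c (or_introl (inb a b ab)) (or_intror (ina c d cd)).
  by rewrite /= !in_itv/= => -[] /andP[]; lra.
have ad : a <= d.
  rewrite leNgt; apply/negP => da.
  have := mid d a (or_intror (inb c d cd)) (or_introl (ina a b ab)).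
  by rewrite /= !in_itv/= => -[] /andP[]; lra.
have -> : `[a, b]%classic `|` `[c, d]%classic =
    `[Num.min a c, Num.max b d]%classic.
  apply/seteqP; split=> x /=; rewrite !in_itv/= ge_min le_max.
    by move=> [] /andP[-> ->]; rewrite ?orbT.
  move=> /andP[/orP ? /orP ?]; have [xb|bx] := leP x b.
    have [ax|xa] := leP a x; [left; lra|right]; lra.
  right; lra.
have -> : `[a, b]%classic `&` `[c, d]%classic =
    `[Num.max a c, Num.min b d]%classic.
  apply/seteqP; split=> x /=; rewrite !in_itv/= le_min ge_max.
    by move=> [/andP[-> ->] /andP[-> ->]].
  by move=> /andP[/andP[-> ->] /andP[-> ->]].
rewrite !repr// ?ge_max ?ge_min ?le_max ?le_min ?ab ?cd ?ad ?cb//.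
by case: (leP a c); case: (leP b d); lra.
Qed.

(** A segment is recovered from its infimum and supremum, which turns the formula into a function of
    the set. *)
Lemma representation_realizable f g :
  exists phi, phi set0 = 0 /\ represents f g phi.
Proof.
exists (fun K => if K == set0 then 0 else g (sup K) - f (inf K)).
split=> [|a b ab]; first by rewrite eqxx.
rewrite ifF; last first.
  by apply/negP => /eqP /seteqP[/(_ a)]/=; rewrite in_itv/= lexx ab => /(_ isT).
by rewrite set_itvcc sup_itvcc// inf_itvcc.
Qed.

Lemma integer_valuedP phi f g : phi set0 = 0 -> f 0 = 0 -> represents f g phi ->
  integer_valued phi <->
  (forall x, f x \is a Num.int) /\ (forall x, g x \is a Num.int).
Proof.
move=> phi0 f0 repr; split=> [intphi|[intf intg] K [->|[a [b [ab ->]]]]];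
  [|by rewrite phi0 int_num0|by rewrite repr// rpredB].
have int a b : a <= b -> g b - f a \is a Num.int.
  by move=> ab; rewrite -repr//; exact/intphi/K1_segment.
have intg x : g x \is a Num.int.
  have [x0|x0] := leP 0 x; first by have := int 0 x x0; rewrite f0 subr0.
  (* For x < 0, an alternating sum of the values of [phi] on [x,x], [x,0] and [0,0]. *)
  have -> : g x = (g x - f x) - (g 0 - f x) + (g 0 - f 0) by rewrite f0; ring.
  by apply: rpredD; first apply: rpredB; apply: int => //; exact: ltW.
split=> // x; have -> : f x = g x - (g x - f x) by ring.
by rewrite rpredB// int.
Qed.

(** Moving a single endpoint of a segment isolates [f] or [g]; the inequality between them is
    nonnegativity on degenerate segments. *)
Lemma monotone_valuationP phi f g : phi set0 = 0 -> represents f g phi ->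
  monotone_valuation phi <->
  {homo f : x y / x <= y} /\ {homo g : x y / x <= y} /\ (forall x, f x <= g x).
Proof.
move=> phi0 repr; split=> [mono|[fhomo [ghomo fg]] K L].
  have M a b c d : a <= b -> c <= a -> b <= d -> g b - f a <= g d - f c.
    move=> ab ca bd; rewrite -!repr//; last lra.
    by apply: mono; [apply: K1_segment; lra..|exact/subset_segmentP].
  split=> [x y xy|]; [by have := M y y x y (lexx y) xy (lexx y); lra|split=> [x y xy|x]].
    by have := M x x x y (lexx x) (lexx x) xy; lra.
  rewrite -subr_ge0 -repr// -phi0; apply: mono => //; first by left.
  exact: K1_segment.
move=> [->|[a [b [ab ->]]]] [->|[c [d [cd ->]]]] //.
- move=> _; rewrite phi0 repr// subr_ge0 (le_trans (fhomo _ _ cd))//.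
- by move=> /(_ a)[]; rewrite /= in_itv/= lexx.
- move=> /(subset_segmentP _ _ ab)[/fhomo ? /ghomo ?].
  by rewrite !repr//; lra.
Qed.

End representation.

(** * Sigma-continuity and one-sided continuity *)

Section continuity.
Context (R : realType).
Implicit Types (phi : set R -> R) (f g : R -> R).

(** Compactness: if every [K_ n] met [J], points chosen in these intersections would have a cluster
    point. It would lie in [J] and in each [K_ n], since these sets are closed and contain a tail of
    the points. *)
Lemma decreasing_K1_disjoint (K_ : nat -> set R) (J : set R) :
  (forall n, K1 (K_ n)) -> (forall m n, (m <= n)%N -> K_ n `<=` K_ m) ->
  closed J -> \bigcap_n K_ n `&` J = set0 ->
  \forall n \near \oo, K_ n `&` J = set0.
Proof.
move=> K1K decK closedJ disj.
have closedK n : closed (K_ n).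
  by have [->|[a [b [_ ->]]]] := K1K n; [exact: closed0|exact: interval_closed].
have compactK : compact (K_ 0%N).
  by have [->|[a [b [_ ->]]]] := K1K 0%N; [exact: compact0|exact: segment_compact].
have [[N KN0]|] := pselect (exists N, K_ N `&` J = set0).
  exists N => // n /= Nn; rewrite -subset0 -KN0.
  by apply: setSI; exact: decK.
move=> /forallNP hit; exfalso.
have /choice[x xP] n : exists x, (K_ n `&` J) x.
  by apply/set0P/eqP; exact: hit.
have [|y [_ yclust]] := compactK (x @ \oo).
  by exists 0%N => // n _ /=; apply: decK (leq0n n) _ _; case: (xP n).
have clust (C : set R) m : closed C -> (forall n, (m <= n)%N -> C (x n)) -> C y.
  move=> closedC Cx; apply: closedC => V Vy.
  by apply: yclust => //; exists m => // n /= mn; exact: Cx.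
suff : (\bigcap_n K_ n `&` J) y by rewrite disj.
split=> [n _|]; last by apply: (clust _ 0%N) => // n _; case: (xP n).
by apply: (clust _ n) => // m nm; apply: decK nm _ _; case: (xP m).
Qed.

(* Monotonicity of the sequence is what makes the segments [u n, x] decrease, as
   [sigma_continuous] requires. *)
Lemma nondecreasing_noncvg_at_left (h : R -> R) (x : R) :
  ~ (h @ x^'- --> h x) ->
  exists2 e : R, 0 < e & exists u : nat -> R,
    [/\ {homo u : m n / (m <= n)%N >-> m <= n}, forall n, u n < x,
        forall n, x - n.+1%:R^-1 < u n & forall n, e <= `|h x - h (u n)| ].
Proof.
move=> /cvgrPdist_lt/existsNP[e /not_implyP[e0 hNcvg]]; exists e => //.
have /choice[s sP] z : exists y, z < x -> [/\ z < y, y < x & e <= `|h x - h y| ].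
  have [zx|xz] := ltP z x; last by exists x.
  apply: contra_notP hNcvg => /forallNP far.
  near=> y.
  have : ~ e <= `|h x - h y|.
    by move=> ey; apply: (far y) => _; split=> //; near: y; exact: nbhs_left_gt.
  by move/negP; rewrite -ltNge.
(* The next threshold is at least the previous chosen point, so that the chosen points increase, and
   at least x - 1/(n+1) at rank n, so that they tend to x. *)
pose z := fix z n := if n is m.+1
  then Num.max (s (z m)) (x - m.+2%:R^-1) else x - 1%:R^-1.
have invx n : x - n.+1%:R^-1 < x by rewrite ltrBlDr ltrDl invr_gt0.
have zx n : z n < x.
  elim: n => [|n IH] /=; first exact: (invx 0%N).
  by rewrite gt_max invx andbT; have [] := sP _ IH.
have zinv n : x - n.+1%:R^-1 <= z n.
  by case: n => [|n] //=; rewrite le_max lexx orbT.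
exists (s \o z); split=> [|n /=|n /=|n /=].
- apply: homo_leq => [y|y v w|n /=]; first exact: lexx.
    exact: le_trans.
  have [] := sP _ (zx n.+1); move/ltW => + _ _; apply: le_trans.
  by rewrite /= le_max lexx.
- by have [] := sP _ (zx n).
- by have [+ _ _] := sP _ (zx n); exact: le_lt_trans.
- by have [] := sP _ (zx n).
Unshelve. all: by end_near. Qed.

(** Reflection lets the sequence constructed on the left of a point serve on the right as well. *)
Lemma cvg_at_right_comp_opp (h : R -> R) (x : R) :
  h @ x^'+ --> h x <-> (h \o -%R) @ (- x)^'- --> (h \o -%R) (- x).
Proof. by rewrite /= opprK; split=> /cvg_at_rightNP. Qed.

(** If left-continuity fails at x, there are segments [u n, x] decreasing to {x} on which [phi]
    stays at distance at least e from its value at {x}, because only the term in [f] varies. *)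
Lemma sigma_continuous_left phi f g : represents f g phi ->
  sigma_continuous phi -> left_continuous_fun f.
Proof.
move=> repr sigma x; apply: contrapT => /nondecreasing_noncvg_at_left.
move=> [e e0 [u [homou ux xu far]]].
have : phi `[u n, x]%classic @[n --> \oo] --> phi `[x, x]%classic.
  apply: sigma => [n||m n mn|]; first exact/K1_segment/ltW.
  - exact: K1_segment.
  - by apply/subset_segmentP; [exact: ltW|split=> //; exact: homou].
  apply/seteqP; split=> y /=; rewrite ?in_itv/=; last first.
    by move=> /andP[xy yx] n _; rewrite /= in_itv/= yx (le_trans _ xy)// ltW.
  move=> Ky; have := Ky 0%N I; rewrite /= in_itv/= => /andP[_ yx].
  rewrite yx andbT leNgt; apply/negP => /ltr_add_invr[k]; rewrite -ltrBrDr => yk.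
  by have := Ky k I; rewrite /= in_itv/= yx andbT leNgt (lt_trans yk).
move=> /cvgrPdist_lt/(_ e e0)[N _ /(_ N (leqnn N))] /=.
rewrite !repr//; last exact: ltW.
have -> : g x - f x - (g x - f (u N)) = - (f x - f (u N)) by ring.
by rewrite normrN ltNge far.
Qed.

(** Mirror image of the left case: [u] increases to - x, so the segments [x, - u n] decrease to {x},
    and only the term in [g] varies. *)
Lemma sigma_continuous_right phi f g : represents f g phi ->
  sigma_continuous phi -> right_continuous_fun g.
Proof.
move=> repr sigma x; rewrite cvg_at_right_comp_opp; apply: contrapT.
move=> /nondecreasing_noncvg_at_left[e e0 [u [homou ux xu far]]].
have xNu n : x < - u n by rewrite ltrNr.
have : phi `[x, - u n]%classic @[n --> \oo] --> phi `[x, x]%classic.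
  apply: sigma => [n||m n mn|]; first exact/K1_segment/ltW.
  - exact: K1_segment.
  - by apply/subset_segmentP; [exact: ltW|rewrite lerN2; split=> //; exact: homou].
  apply/seteqP; split=> y /=; rewrite ?in_itv/=; last first.
    by move=> /andP[xy yx] n _; rewrite /= in_itv/= xy (le_trans yx)// ltW.
  move=> Ky; have := Ky 0%N I; rewrite /= in_itv/= => /andP[xy _].
  rewrite xy/= leNgt; apply/negP => /ltr_add_invr[k yk].
  have := Ky k I; rewrite /= in_itv/= xy/= leNgt (_ : - u k < y)//.
  by rewrite ltrNl (le_lt_trans _ (xu k))// -opprD lerN2 ltW.
move=> /cvgrPdist_lt/(_ e e0)[N _ /(_ N (leqnn N))] /=.
rewrite !repr//; last exact: ltW.
have -> : g x - f x - (g (- u N) - f x) = g x - g (- u N) by ring.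
by have := far N; rewrite /= opprK ltNge => ->.
Qed.

Lemma at_left_itv (x : R) (P : set R) : (\forall y \near x^'-, P y) ->
  exists2 z, z < x & forall y, z < y -> y < x -> P y.
Proof.
move=> [d /= d0 dP]; exists (x - d) => [|y xy yx]; first by rewrite ltrBlDr ltrDl.
by apply: dP => //=; rewrite gtr0_norm; lra.
Qed.

Lemma at_right_itv (x : R) (P : set R) : (\forall y \near x^'+, P y) ->
  exists2 z, x < z & forall y, x < y -> y < z -> P y.
Proof.
move=> [d /= d0 dP]; exists (x + d) => [|y xy yx]; first by rewrite ltrDl.
by apply: dP => //=; rewrite ltr0_norm; lra.
Qed.

Lemma sigma_continuousP phi f g : phi set0 = 0 -> represents f g phi ->
  sigma_continuous phi <-> left_continuous_fun f /\ right_continuous_fun g.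
Proof.
move=> phi0 repr; split=> [sigma|[fleft gright] K_ K K1K K1lim decK capK].
  split; first exact: sigma_continuous_left repr sigma.
  exact: sigma_continuous_right repr sigma.
have disj J := decreasing_K1_disjoint (J := J) K1K decK; rewrite capK in disj.
have [K0|[a [b [ab KE]]]] := K1lim.
  (* Taking the whole line for [J] shows that [K_ n] is itself eventually empty. *)
  have [||N _ KN] := disj setT; [exact: closedT|by rewrite K0 set0I|].
  rewrite K0; apply: cvg_near_cst; exists N => // n /KN.
  by rewrite setIT => ->.
apply/cvgrPdist_lt => e e0; have e20 : 0 < e / 2 by rewrite divr_gt0.
have [z za fz] := at_left_itv ((cvgrPdist_lt _ _).1 (fleft a) _ e20).
have [w bw gw] := at_right_itv ((cvgrPdist_lt _ _).1 (gright b) _ e20).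
(* Eventually [K_ n] avoids the closed rays ending at z and starting at w. Its endpoints then lie in
   (z,a] and [b,w), where [f] and [g] differ from f(a) and g(b) by less than e/2. *)
have Nz : \forall n \near \oo, K_ n `&` `]-oo, z]%classic = set0.
  apply: disj; first exact: lray_closed.
  by apply/seteqP; split=> // y; rewrite KE /= !in_itv/= => -[/andP[]]; lra.
have Nw : \forall n \near \oo, K_ n `&` `[w, +oo[%classic = set0.
  apply: disj; first exact: rray_closed.
  by apply/seteqP; split=> // y; rewrite KE /= !in_itv/= => -[/andP[]]; lra.
near=> n.
have KKn : K `<=` K_ n by rewrite -capK => y; exact.
have [Kn0|[c [d [cd KnE]]]] := K1K n.
  by have := KKn a; rewrite KE Kn0 /= in_itv/= lexx => /(_ ab).
have [ca bd] : c <= a /\ b <= d.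
  by move: KKn; rewrite KnE KE => /(subset_segmentP _ _ ab).
have zc : z < c.
  rewrite ltNge; apply/negP => cz.
  have : (K_ n `&` `]-oo, z]%classic) c by rewrite KnE /= !in_itv/= lexx cd cz.
  by rewrite (near Nz n).
have dw : d < w.
  rewrite ltNge; apply/negP => wd.
  have : (K_ n `&` `[w, +oo[%classic) d by rewrite KnE /= !in_itv/= lexx cd wd.
  by rewrite (near Nw n).
rewrite KE KnE !repr//.
have -> : g b - f a - (g d - f c) = (g b - g d) - (f a - f c) by ring.
rewrite (splitr e) (le_lt_trans (ler_normB _ _))// ltrD//.
- move: bd; rewrite le_eqVlt => /predU1P[->|bd]; last exact: gw.
  by rewrite subrr normr0.
- move: ca; rewrite le_eqVlt => /predU1P[->|ca]; last exact: fz.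
  by rewrite subrr normr0.
Unshelve. all: by end_near. Qed.

End continuity.

(** * Finitely supported sums and counting of integers *)

Section finitely_supported_sums.

(** Passes from families indexed by integer levels to families indexed by naturals, finite or
    infinite in number. *)
Lemma index_set_enumeration (D : set int) :
  exists (N : option nat) (e : nat -> int), set_bij (index_set N) D e.
Proof.
(* The library has no pointed structure on [int], which [card_set_bijP] needs. *)
pose pint : pointedType := HB.pack int (isPointed.Build int 0).
have [|Dinf] := pselect (finite_set D).
  move=> /finite_setP[n] /card_esym/(card_set_bijP (U := pint))[e eb].
  by exists (Some n), e.
have /card_esym/(card_set_bijP (U := pint))[e eb] :=
  eq_card_nat (countableP D) Dinf.
by exists None, e.
Qed.

(** Transfers local finiteness along an enumeration: [e] is injective on the set in question and
    maps it into a finite one. *)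
Lemma finite_set_reindex (I J : Type) (e : I -> J) (A : set I) (B C : set J) :
  set_bij A B e -> finite_set (B `&` C) -> finite_set (A `&` e @^-1` C).
Proof.
move=> [eAB einj _] finBC.
rewrite -(eq_finite_set (inj_card_eq (f := e) _)); last first.
  by move=> x y; rewrite !inE => -[Ax _] [Ay _]; apply: einj; rewrite inE.
by apply: sub_finite_set finBC => _ [x [Ax Cx] <-]; split=> //; exact: eAB.
Qed.

Lemma fsum_int (R : realType) (I : choiceType) (D : set I) (F : I -> R) :
  (forall i, F i \is a Num.int) -> \sum_(i \in D) F i \is a Num.int.
Proof. by move=> intF; apply: rpred_sum. Qed.

(** A sum with infinite support is 0 by convention, so comparison requires [G] to have finite
    support; [F], squeezed between 0 and [G], vanishes wherever [G] does. *)
Lemma ler_fsum_supp (R : realType) (I : choiceType) (D : set I) (F G : I -> R) :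
  finite_set [set i | D i /\ G i != 0] ->
  (forall i, D i -> 0 <= F i) -> (forall i, D i -> F i <= G i) ->
  \sum_(i \in D) F i <= \sum_(i \in D) G i.
Proof.
move=> finG F0 FG; set A := [set i | _] in finG.
have AD : A `<=` D by move=> i [].
have Gout i : (D `\` A) i -> G i = 0.
  by move=> [Di]; apply: contra_notP => /eqP.
have Fout i : (D `\` A) i -> F i = 0.
  move=> DAi; apply/eqP; rewrite eq_le F0 ?andbT; last by case: DAi.
  by rewrite -(Gout _ DAi) FG//; case: DAi.
rewrite -!(fsbig_widen _ _ _ AD)// !fsbig_finite//=.
rewrite big_seq [leRHS]big_seq; apply: ler_sum => i.
by rewrite in_fset_set// inE => -[Di _]; exact: FG.
Qed.

(** Meant for [W] the integers counted by g(b) - f(a) and [D1], [D2], [D3] the three kinds of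
    levels. Neither side need contain the other: each piece of [W] is widened to the whole [Di] by
    zero terms. *)
Lemma fsum_split3 (R : realType) (I : choiceType) (W D1 D2 D3 : set I)
    (F : I -> R) :
  finite_set W -> (forall i, ~ W i -> F i = 0) ->
  D1 `&` D2 = set0 -> (D1 `|` D2) `&` D3 = set0 ->
  (forall i, ~ D1 i -> ~ D2 i -> ~ D3 i -> F i = 0) ->
  \sum_(i \in W) F i =
  \sum_(i \in D1) F i + \sum_(i \in D2) F i + \sum_(i \in D3) F i.
Proof.
move=> finW FW D12 D123 Fout.
rewrite (fsbigID D1)// (fsbigID D2 (W `&` ~` D1)); last exact: finite_setIl.
rewrite -[LHS]/(_ + (_ + _)) addrA; congr (_ + _ + _).
- by apply: fsbig_widen => [i []//|i [Di nWDi]]; apply: FW => Wi; exact: nWDi.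
- apply: fsbig_widen => [i []//|i [Di nWDi]]; apply: FW => Wi; apply: nWDi.
  by split=> //; split=> // D1i; have : (D1 `&` D2) i by []; rewrite D12.
- rewrite -(fsbig_widen (W `&` D3) D3); first last.
  + by move=> i [Di nWDi]; apply: FW => Wi; exact: nWDi.
  + by move=> i [].
  apply/esym/fsbig_widen => i [].
    move=> Wi D3i; have nD : ~ ((D1 `|` D2) `&` D3) i by rewrite D123.
    by split; [split|] => //; move=> Di; apply: nD; split=> //; [left|right].
  by move=> [[Wi D1i] D2i] nWD3; apply: Fout => // D3i; exact: nWD3.
Qed.

Lemma finite_int_itv (m n : int) : finite_set [set k : int | m < k <= n].
Proof.
suff : [set k : int | m < k <= n] `<=`
    (fun i : nat => m + i%:Z) @` `I_(`|n - m|%N.+1).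
  by move/sub_finite_set; apply; exact/finite_image/finite_II.
move=> k /= mkn; exists `|k - m|%N; first by rewrite /=; lia.
by lia.
Qed.

Lemma count_int_itv (R : realType) (m n : int) : m <= n ->
  \sum_(k \in [set k : int | m < k <= n]) (1 : R) = n%:~R - m%:~R.
Proof.
move=> mn; rewrite (reindex_fsbig (fun i : nat => m + i.+1%:Z) `I_(`|n - m|%N)).
  rewrite -fsbig_ord sumr_const card_ord -intrB.
  by rewrite -[n - m]gez0_abs ?subr_ge0.
split=> [i|i j _ _|k] /=; [lia|lia|move=> mkn].
by exists `|k - m|%N.-1; rewrite /=; lia.
Qed.

End finitely_supported_sums.

(** * From sums of indicators to properties of the valuation *)

Section sufficiency.
Context (R : realType).
Implicit Types (phi : set R -> R) (J : nat -> set R) (N : option nat).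

(** The sets [J n] are arbitrary here: integrality and monotonicity depend only on local finiteness,
    so one notion serves both (iv) and (v). *)
Definition finite_sum_representation phi :=
  exists (N1 N2 N3 : option nat) (J : nat -> set R) (r s : nat -> R),
    [/\ locally_finite_itvs N1 J, locally_finite_points N2 r,
        locally_finite_points N3 s &
        forall a b : R, a <= b -> phi `[a, b]%classic =
          hitting_sum N1 J a b + oc_sum N2 r a b + co_sum N3 s a b].

Lemma finite_sum_int phi : phi set0 = 0 -> finite_sum_representation phi ->
  integer_valued phi.
Proof.
move=> phi0 [N1 [N2 [N3 [J [r [s [_ _ _ phiE]]]]]]] K.
move=> [->|[a [b [ab ->]]]]; first by rewrite phi0.
by rewrite phiE// !rpredD//; apply: fsum_int => i; exact: natr_int.
Qed.

(** Each indicator can only grow with the segment, and local finiteness on the larger segment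
    provides the finite support needed to compare the sums. *)
Lemma finite_sum_monotone phi : phi set0 = 0 -> finite_sum_representation phi ->
  monotone_valuation phi.
Proof.
move=> phi0 [N1 [N2 [N3 [J [r [s [finJ finr fins phiE]]]]]]].
have phi_ge0 a b : a <= b -> 0 <= phi `[a, b]%classic.
  by move=> ab; rewrite phiE// !addr_ge0//; apply: fsumr_ge0 => i _; rewrite ler0n.
move=> K L [->|[a [b [ab ->]]]] [->|[c [d [cd ->]]]].
- by [].
- by move=> _; rewrite phi0 phi_ge0.
- by move=> /(_ a); rewrite /= in_itv/= lexx ab => /(_ isT).
move=> sub; have [ca bd] := (subset_segmentP _ _ ab).1 sub.
have ler_bool (x y : bool) : (x -> y) -> x%:R <= y%:R :> R.
  by case: x y => [] [] //= /(_ isT).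
rewrite !phiE// !lerD//.
- apply: ler_fsum_supp => [|i _|i _]; [|by rewrite ler0n|].
    apply: sub_finite_set (finJ _ _ cd) => i [Ni Hi]; split=> //.
    by move: Hi; case: asboolP => //; rewrite eqxx.
  apply: ler_bool => /asboolP[x [abx Jx]].
  by apply/asboolP; exists x; split=> //; exact: sub.
- apply: ler_fsum_supp => [|i _|i _]; [|by rewrite ler0n|].
    apply: sub_finite_set (finr _ _ cd) => i [Ni Hi]; split=> //.
    by apply: contraNT Hi; rewrite pnatr_eq0 eqb0; apply: contra;
      rewrite !in_itv/= => /andP[/ltW -> ->].
  apply: ler_bool; rewrite !in_itv/= => /andP[ai ib]; by apply/andP; split; lra.
- apply: ler_fsum_supp => [|i _|i _]; [|by rewrite ler0n|].
    apply: sub_finite_set (fins _ _ cd) => i [Ni Hi]; split=> //.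
    by apply: contraNT Hi; rewrite pnatr_eq0 eqb0; apply: contra;
      rewrite !in_itv/= => /andP[-> /ltW ->].
  apply: ler_bool; rewrite !in_itv/= => /andP[ai ib]; by apply/andP; split; lra.
Qed.

Lemma closed_ext_itv (p q : \bar R) : (p <= q)%E ->
  closed (ext_itv true true p q).
Proof.
rewrite le_eqVlt /ext_itv => /predU1P[->|pq].
  rewrite eqxx; case: q => [x| |].
  - rewrite (_ : [set _ | _] = [set x]); first exact: closed_eq.
    by apply/seteqP; split=> y /= => [[]|->].
  (* Equal infinite endpoints, which [itv_endpoints] would exclude, give the empty set. *)
  - by rewrite (_ : [set _ | _] = set0)//; [exact: closed0|apply/seteqP; split].
  - by rewrite (_ : [set _ | _] = set0)//; [exact: closed0|apply/seteqP; split].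
rewrite (lt_eqF pq); case: p q pq => [x| |] [y| |]//= _.
- rewrite (_ : [set _ | _] = `[x, y]%classic); first exact: interval_closed.
  by apply/seteqP; split=> z /=; rewrite !in_itv/= !lee_fin.
- rewrite (_ : [set _ | _] = `[x, +oo[%classic); first exact: rray_closed.
  by apply/seteqP; split=> z /=; rewrite !in_itv/= !lee_fin leey.
- rewrite (_ : [set _ | _] = `]-oo, y]%classic); first exact: lray_closed.
  by apply/seteqP; split=> z /=; rewrite !in_itv/= !lee_fin leNye.
- rewrite (_ : [set _ | _] = setT); first exact: closedT.
  by apply/seteqP; split=> z //= _; rewrite in_itv/= leNye leey.
Qed.

(** Only the finitely many members that hit [K_ 0] can hit a later [K_ n]. Those hitting [K] hit
    every [K_ n]; by compactness each of the others is eventually missed. Hence [phi (K_ n)] is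
    eventually equal to [phi K]. *)
Lemma hitting_sum_sigma_continuous phi N J : phi set0 = 0 ->
  (forall n, index_set N n -> closed (J n)) -> locally_finite_itvs N J ->
  (forall a b : R, a <= b -> phi `[a, b]%classic = hitting_sum N J a b) ->
  sigma_continuous phi.
Proof.
move=> phi0 closedJ finJ phiE.
have phiK K : K1 K ->
    phi K = \sum_(n \in index_set N) ((`[< K `&` J n !=set0 >])%:R : R).
  move=> [->|[a [b [ab ->]]]]; last exact: phiE.
  rewrite phi0 fsbig1// => i _; case: asboolP => // -[x].
  by rewrite set0I.
move=> K_ K K1K K1lim decK capK.
have KKn n : K `<=` K_ n by rewrite -capK => y; exact.
pose S := [set i | index_set N i /\ K_ 0%N `&` J i !=set0].
have finS : finite_set S.
  have [K0|[a [b [ab KE]]]] := K1K 0%N; last by rewrite /S KE; exact: finJ.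
  by rewrite (_ : S = set0)//; apply/seteqP; split=> i // -[_ []x]; rewrite K0 set0I.
have nearS i : S i -> \forall n \near \oo,
    `[< K_ n `&` J i !=set0 >] = `[< K `&` J i !=set0 >].
  move=> [Ni _]; have [KJ|KJ0] := pselect (K `&` J i !=set0).
    apply: nearW => n; rewrite !asboolT//.
    by move: KJ => [x [Kx Jx]]; exists x; split=> //; exact: KKn.
  have [|m _ mP] := decreasing_K1_disjoint K1K decK (closedJ i Ni).
    by rewrite capK; apply/eqP/negPn/negP => /set0P.
  by exists m => // n /mP ->; rewrite !asboolF// => -[].
have [M MP] : exists M, forall n i, (M <= n)%N -> S i ->
    `[< K_ n `&` J i !=set0 >] = `[< K `&` J i !=set0 >].
  have /choice[m mP] i : exists m, S i -> forall n, (m <= n)%N ->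
      `[< K_ n `&` J i !=set0 >] = `[< K `&` J i !=set0 >].
    have [/nearS[m _ mP]|] := pselect (S i); last by exists 0%N.
    by exists m => _ n; exact: mP.
  have [X XS] := (finite_seqP _).1 finS.
  exists (\max_(i <- X) m i)%N => n i mn Si; apply: mP => //.
  by apply: leq_trans mn; apply: leq_bigmax_seq => //; move: Si; rewrite XS.
apply: cvg_near_cst; exists M => // n /= Mn; rewrite !phiK//.
apply: eq_fsbigr => i; rewrite inE => Ni; congr (nat_of_bool _)%:R.
have [Si|nSi] := pselect (S i); first exact: MP.
rewrite !asboolF// => -[x [Kx Jx]]; apply: nSi; split=> //; exists x; split=> //.
  exact: KKn.
exact: decK (leq0n n) _ _.
Qed.

End sufficiency.

(** * Up-sets of the line, their differences, and intervals with extended endpoints *)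

Section necessity.
Context (R : realType).
Implicit Types (U V X : set R) (f g : R -> R).

Definition upset U := forall x y : R, x <= y -> U x -> U y.

(** A nontrivial up-set is bounded below by any point outside it and contains everything above its
    infimum; the last two cases differ by whether it contains the infimum. *)
Lemma upset_cases U : upset U -> [\/ U = set0, U = setT,
  exists w, U = [set x | w <= x] | exists w, U = [set x | w < x] ].
Proof.
move=> upU; have [->|/set0P[x Ux]] := eqVneq U set0; first by constructor 1.
have [->|/eqP UT] := eqVneq U setT; first by constructor 2.
have [z nUz] : exists z, ~ U z.
  by apply/existsNP => allU; apply: UT; apply/seteqP; split=> // y _; exact: allU.
have lbz : lbound U z.
  by move=> y Uy; rewrite leNgt; apply/negP => /ltW/upU/(_ Uy).
have infU : has_inf U by split; [exists x|exists z].
have infUle y : U y -> inf U <= y by move=> Uy; apply: ge_inf => //; exists z.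
have Ugt y : inf U < y -> U y.
  by move=> /(inf_lt infU.1)[t Ut /ltW ty]; exact: (upU _ _ ty Ut).
have [Uinf|nUinf] := pselect (U (inf U)).
  constructor 3; exists (inf U); apply/seteqP; split=> y /=.
    exact: infUle.
  by move=> infy; exact: (upU _ _ infy Uinf).
constructor 4; exists (inf U); apply/seteqP; split=> y /= => [Uy|]; last exact: Ugt.
rewrite lt_neqAle infUle// andbT; apply/eqP => infy.
by apply: nUinf; rewrite infy.
Qed.

(** For the converse, if neither a nor b lies in the difference, then b is in [U] and a is not in
    [V]. Any point of the difference is then in [a,b]: below a it would put a in [V], above b it
    would be in [U]. *)
Lemma upset_diff_hit U V a b : upset U -> upset V -> U `<=` V -> U <> V ->
  a <= b -> `[a, b] `&` (V `\` U) !=set0 <-> V b /\ ~ U a.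
Proof.
move=> upU upV UV neqUV ab; split=> [[x []]|[Vb nUa]].
  rewrite /= in_itv/= => /andP[ax xb] [Vx nUx].
  by split; [exact: (upV _ _ xb Vx)|move=> /(upU _ _ ax)].
have [Ub|nUb] := pselect (U b); last first.
  by exists b; split=> //; rewrite /= in_itv/= ab lexx.
have [Va|nVa] := pselect (V a).
  by exists a; split=> //; rewrite /= in_itv/= ab lexx.
have [x [Vx nUx]] : V `\` U !=set0.
  by apply/set0P/eqP => VU0; apply: neqUV; apply/seteqP; split=> //; rewrite -setD_eq0.
exists x; split=> //; rewrite /= in_itv/=; apply/andP; split.
  by rewrite leNgt; apply/negP => /ltW/upV/(_ Vx).
by rewrite leNgt; apply/negP => /ltW/upU/(_ Ub).
Qed.

Lemma is_interval_upset_diff U V : upset U -> upset V -> is_interval (V `\` U).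
Proof.
move=> upU upV x y [Vx _] [_ nUy] z /andP[xz zy].
by split; [exact: (upV _ _ xz Vx)|move=> /(upU _ _ zy)].
Qed.

Lemma in_ext_itv_le cl cr (p q x : \bar R) :
  x \in Interval (BSide cl p) (BSide (~~ cr) q) -> (p <= x)%E && (x <= q)%E.
Proof.
rewrite in_itv; case: cl cr => [] [] /= /andP[px xq];
  by apply/andP; split=> //; exact: ltW.
Qed.

(** The point x0 lies between p and q, so p = q forces both to be x0, and the convention at equal
    endpoints yields the same set {x0}. *)
Lemma ext_itvE cl cr (p q : \bar R) (x0 : R) :
  x0%:E \in Interval (BSide cl p) (BSide (~~ cr) q) ->
  itv_endpoints p q /\
  [set x : R | x%:E \in Interval (BSide cl p) (BSide (~~ cr) q)] =
    ext_itv cl cr p q.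
Proof.
move=> x0pq; have /andP[px0 x0q] := in_ext_itv_le x0pq.
split.
  split=> [|pq]; first exact: le_trans x0q.
  by rewrite (_ : p = x0%:E)//; apply/eqP; rewrite eq_le px0 pq x0q.
rewrite /ext_itv; case: eqP => // pq.
have pE : p = x0%:E by apply/eqP; rewrite eq_le px0 pq x0q.
apply/seteqP; split=> x /=; last first.
  by move=> xp; have [->] : x%:E = x0%:E by rewrite xp.
by move=> /in_ext_itv_le/andP[px xq]; apply/eqP; rewrite eq_le px pq xq.
Qed.

Lemma interval_ext_itv X : is_interval X -> X !=set0 ->
  exists (cl cr : bool) (p q : \bar R),
    itv_endpoints p q /\ X = ext_itv cl cr p q.
Proof.
move=> /is_intervalP ->; case: (Rhull X) => l u [x0 /= x0lu].
suff [cl [cr [p [q pqE]]]] : exists (cl cr : bool) (p q : \bar R),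
    forall x : R, (x \in Interval l u) =
      (x%:E \in Interval (BSide cl p) (BSide (~~ cr) q)).
  exists cl, cr, p, q.
  have [end_pq <-] : _ /\ _ := ext_itvE (etrans (esym (pqE x0)) x0lu).
  by split=> //; apply/seteqP; split=> x /=; rewrite pqE.
(* Nonemptiness leaves four cases, according to which sides are bounded; an unbounded side becomes
   an infinite endpoint. *)
case: l u x0lu => [bl y|[]] [br z|[]]; rewrite ?in_itv ?andbF//= => _.
- exists bl, (~~ br), y%:E, z%:E => x; rewrite !in_itv/= negbK.
  by case: bl br => [] []; rewrite ?(lee_fin, lte_fin).
- exists bl, false, y%:E, +oo%E => x; rewrite !in_itv/= ltry andbT.
  by case: bl => /=; rewrite ?(lee_fin, lte_fin).
- exists false, (~~ br), -oo%E, z%:E => x; rewrite !in_itv/= ltNyr negbK.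
  by case: br => /=; rewrite ?(lee_fin, lte_fin).
- by exists false, false, -oo%E, +oo%E => x; rewrite !in_itv/= ltNyr ltry.
Qed.

Lemma near_right_lte (x : R) (q : \bar R) :
  (x%:E < q)%E -> \forall y \near x^'+, (y%:E < q)%E.
Proof.
case: q => [q|_|//]; last by apply: nearW => y; rewrite ltry.
by rewrite lte_fin => /nbhs_right_lt; apply: filterS => y; rewrite lte_fin.
Qed.

Lemma near_left_lte (x : R) (p : \bar R) :
  (p < x%:E)%E -> \forall y \near x^'-, (p < y%:E)%E.
Proof.
case: p => [p|//|_]; last by apply: nearW => y; rewrite ltNyr.
by rewrite lte_fin => /nbhs_left_gt; apply: filterS => y; rewrite lte_fin.
Qed.

(** When p < q, a finite endpoint is a one-sided limit of interior points, so a closed interval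
    contains it whatever [cl] and [cr] are. *)
Lemma closed_ext_itvE cl cr (p q : \bar R) : closed (ext_itv cl cr p q) ->
  (p <= q)%E -> ext_itv cl cr p q = ext_itv true true p q.
Proof.
rewrite /ext_itv le_eqVlt => + /predU1P[->|pq]; first by rewrite eqxx.
rewrite (lt_eqF pq) => closedX.
have openX (y : R) : (p < y%:E)%E -> (y%:E < q)%E ->
    y%:E \in Interval (BSide cl p) (BSide (~~ cr) q).
  by move=> py yq; rewrite in_itv; case: cl cr {closedX} => [] []; rewrite /= ?py ?yq ?ltW.
apply/seteqP; split=> x /=; first by move/in_ext_itv_le; rewrite in_itv.
rewrite in_itv/= => /andP[]; rewrite le_eqVlt => /predU1P[px _|px].
  apply: (@closed_cvg _ _ x^'+ _ id _ closedX); last exact: cvg_at_right_filter.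
  near=> y; rewrite /=; apply: openX; first by rewrite px lte_fin.
  by near: y; apply: near_right_lte; rewrite -px.
rewrite le_eqVlt => /predU1P[xq|xq]; last exact: openX.
apply: (@closed_cvg _ _ x^'- _ id _ closedX); last exact: cvg_at_left_filter.
near=> y; rewrite /=; apply: openX; last by rewrite -xq lte_fin.
by near: y; exact: near_left_lte.
Unshelve. all: by end_near. Qed.

End necessity.

(** * Decomposition of g(b) - f(a) by integer levels *)

Section level_sets.
Context (R : realType) (f g : R -> R).
Hypotheses (intf : forall x, f x \is a Num.int) (intg : forall x, g x \is a Num.int).
Hypotheses (homof : {homo f : x y / x <= y}) (homog : {homo g : x y / x <= y}).
Hypothesis (fg : forall x, f x <= g x).

Definition level (h : R -> R) (k : int) : set R := [set x | k%:~R <= h x].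

Definition level_hit (a b : R) (k : int) : Prop := level g k b /\ ~ level f k a.

Definition itv_levels : set int := [set k | level f k <> level g k].

Definition oc_levels : set int := [set k | level f k = level g k /\
  exists w, level g k = [set x | w <= x] ].

Definition co_levels : set int := [set k | level f k = level g k /\
  exists w, level g k = [set x | w < x] ].

Lemma upset_level h k : {homo h : x y / x <= y} -> upset (level h k).
Proof. by move=> homoh x y /homoh xy /le_trans; apply. Qed.

Lemma sub_level k : level f k `<=` level g k.
Proof. by move=> x /le_trans; apply. Qed.

Lemma level_hit_itv k a b : itv_levels k -> a <= b ->
  `[a, b] `&` (level g k `\` level f k) !=set0 <-> level_hit a b k.
Proof.
move=> neq; apply: upset_diff_hit neq; [exact: upset_level..|exact: sub_level].
Qed.

Lemma level_hit_oc k : oc_levels k ->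
  exists r, forall a b, level_hit a b k <-> r \in `]a, b].
Proof.
move=> [fgE [w gE]]; exists w => a b; rewrite /level_hit fgE gE /= in_itv/=.
split=> [[-> /negP]|/andP[aw ->]]; first by rewrite -ltNge => ->.
by split=> //; apply/negP; rewrite -ltNge.
Qed.

Lemma level_hit_co k : co_levels k ->
  exists s, forall a b, level_hit a b k <-> s \in `[a, b[.
Proof.
move=> [fgE [w gE]]; exists w => a b; rewrite /level_hit fgE gE /= in_itv/=.
split=> [[-> /negP]|/andP[aw ->]]; first by rewrite -leNgt => ->.
by split=> //; apply/negP; rewrite -leNgt.
Qed.

(** Integrality makes the levels hit an integer interval, which yields both their finiteness and
    their number. *)
Lemma level_hitP a b : exists m n : int, [/\ f a = m%:~R, g b = n%:~R &
  forall k, level_hit a b k <-> m < k <= n].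
Proof.
have /intrP[m fa] := intf a; have /intrP[n gb] := intg b.
exists m, n; split=> // k; rewrite /level_hit /level /= fa gb !ler_int.
split=> [[-> /negP]|/andP[mk ->]]; first by rewrite -ltNge => ->.
by split=> //; apply/negP; rewrite -ltNge.
Qed.

Lemma finite_level_hit a b : finite_set [set k | level_hit a b k].
Proof.
have [m [n [_ _ hitE]]] := level_hitP a b.
by apply: sub_finite_set (finite_int_itv m n) => k /hitE.
Qed.

(** The g(b) - f(a) levels that are hit are distributed over the three kinds: by [upset_cases], any
    other level has equal and trivial up-sets and is never hit. *)
Lemma level_sum a b : a <= b ->
  g b - f a = \sum_(k \in itv_levels) ((`[< level_hit a b k >])%:R : R)
    + \sum_(k \in oc_levels) ((`[< level_hit a b k >])%:R : R)
    + \sum_(k \in co_levels) ((`[< level_hit a b k >])%:R : R).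
Proof.
move=> ab; have [m [n [fa gb hitE]]] := level_hitP a b.
have mn : m <= n by rewrite -(ler_int R) -fa -gb (le_trans (homof ab)).
rewrite -(fsum_split3 (finite_int_itv m n)); first last.
- move=> k nitv noc nco; rewrite asboolF// => -[].
  have [fgE|//] := pselect (level f k = level g k).
  have : upset (level g k) by exact: upset_level.
  move=> /upset_cases[gE|gE|[w gE]|[w gE]].
  + by rewrite gE.
  + by rewrite fgE gE.
  + by case: noc; split=> //; exists w.
  + by case: nco; split=> //; exists w.
- apply/seteqP; split=> // k [[neq|[_ [w gE]]] [fgE [v gE']]]; first exact: neq.
  have : level g k w by rewrite gE /=.
  (* A closed ray from w is not an open ray from v: the midpoint is above v but below w. *)
  rewrite gE' /= => vw; have : level g k ((v + w) / 2) by rewrite gE' /=; lra.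
  by rewrite gE /=; lra.
- by apply/seteqP; split=> // k [neq [fgE _]]; exact: neq.
- by move=> k nk; rewrite asboolF// => /hitE.
rewrite fa gb -count_int_itv//; apply: eq_fsbigr => k; rewrite inE /= => mkn.
by rewrite asboolT//; exact/hitE.
Qed.

End level_sets.

(** * Level sets of one-sided continuous functions *)

Section levels_enumeration.
Context (R : realType).
Implicit Types (f g : R -> R).

Lemma int_ge_of_gtB1 (x : R) (k : int) : x \is a Num.int -> k%:~R - 1 < x -> k%:~R <= x.
Proof. by move=> /intrP[m ->]; rewrite ltrBlDr -intrD1 ltr_int ler_int; lia. Qed.

(** Left-continuity gives y < w with f(y) > f(w) - 1 >= k - 1, hence f(y) >= k by integrality,
    although y is outside the ray. *)
Lemma left_continuous_level f k w : (forall x, f x \is a Num.int) ->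
  left_continuous_fun f -> level f k <> [set x | w <= x].
Proof.
move=> intf fleft fE.
have /cvgrPdist_lt/(_ 1 ltr01) nearw := fleft w.
have [y [yw fwy]] : exists y, y < w /\ `|f w - f y| < 1.
  apply: (@filter_ex _ w^'-); apply: filterI nearw; exact: nbhs_left_lt.
have : level f k w by rewrite fE /=.
have : ~ level f k y by rewrite fE /= => /(lt_le_trans yw); rewrite ltxx.
rewrite /level /= => nfy kfw; apply: nfy; apply: int_ge_of_gtB1 => //.
by move: fwy; rewrite ltr_norml; lra.
Qed.

(** Here a point just to the right of w, where [g] is at least k, forces g(w) >= k. *)
Lemma right_continuous_level g k w : (forall x, g x \is a Num.int) ->
  right_continuous_fun g -> level g k <> [set x | w < x].
Proof.
move=> intg gright gE.
have /cvgrPdist_lt/(_ 1 ltr01) nearw := gright w.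
have [y [wy gwy]] : exists y, w < y /\ `|g w - g y| < 1.
  apply: (@filter_ex _ w^'+); apply: filterI nearw; exact: nbhs_right_gt.
have : level g k y by rewrite gE /=.
have : ~ level g k w by rewrite gE /= ltxx.
rewrite /level /= => ngw kgy; apply: ngw; apply: int_ge_of_gtB1 => //.
by move: gwy; rewrite ltr_norml; lra.
Qed.

(** Of the four shapes of an up-set only the closed ray is not open, and left-continuity excludes
    it. *)
Lemma open_level f k : {homo f : x y / x <= y} -> (forall x, f x \is a Num.int) ->
  left_continuous_fun f -> open (level f k).
Proof.
move=> homof intf fleft.
have : upset (level f k) by exact: upset_level.
move=> /upset_cases[->|->|[w fE]|[w ->]].
- exact: open0.
- exact: openT.
- by have := left_continuous_level intf fleft fE.
- exact: open_gt.
Qed.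

Lemma closed_level g k : {homo g : x y / x <= y} -> (forall x, g x \is a Num.int) ->
  right_continuous_fun g -> closed (level g k).
Proof.
move=> homog intg gright.
have : upset (level g k) by exact: upset_level.
move=> /upset_cases[->|->|[w ->]|[w gE]].
- exact: closed0.
- exact: closedT.
- exact: closed_ge.
- by have := right_continuous_level intg gright gE.
Qed.

End levels_enumeration.

(** * From integer levels to enumerated families of intervals and points *)

Section levels_reindexing.
Context (R : realType) (f g : R -> R).
Hypotheses (intf : forall x, f x \is a Num.int) (intg : forall x, g x \is a Num.int).
Hypotheses (homof : {homo f : x y / x <= y}) (homog : {homo g : x y / x <= y}).
Hypothesis (fg : forall x, f x <= g x).
Local Notation hit_sum D a b :=
  (\sum_(k \in D) ((`[< level_hit f g a b k >])%:R : R)).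

(** [J] is a parameter so that the same enumeration serves intervals of any type in (iv) and closed
    ones in (v). *)
Lemma itv_levels_hitting_sum (J : int -> set R) :
  (forall k, itv_levels f g k -> J k = level g k `\` level f k) ->
  exists N (e : nat -> int),
    [/\ forall n, index_set N n -> itv_levels f g (e n),
        locally_finite_itvs N (fun n => J (e n)) &
        forall a b, a <= b ->
          hitting_sum N (fun n => J (e n)) a b = hit_sum (itv_levels f g) a b].
Proof.
move=> JE; have [N [e eb]] := index_set_enumeration (itv_levels f g).
have hitJ k a b : itv_levels f g k -> a <= b ->
    `[a, b] `&` J k !=set0 <-> level_hit f g a b k.
  by move=> Dk ab; rewrite JE//; exact: level_hit_itv.
exists N, e; split=> [|a b ab|a b ab]; first by case: eb.
  apply: (finite_set_reindex (C := [set k | `[a, b] `&` J k !=set0]) eb).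
  apply: sub_finite_set (finite_level_hit intf intg a b) => k [Dk].
  by move/(hitJ k a b Dk ab).
rewrite (reindex_fsbig _ _ _ _ eb); apply: eq_fsbigr => n; rewrite inE => Nn.
congr (nat_of_bool _)%:R; apply: asbool_equiv_eq; apply: hitJ => //.
by case: eb => eND _ _; exact: eND.
Qed.

Lemma oc_levels_sum : exists N (r : nat -> R), locally_finite_points N r /\
  forall a b, oc_sum N r a b = hit_sum (oc_levels f g) a b.
Proof.
have [N [e eb]] := index_set_enumeration (oc_levels f g).
have /choice[r rP] k : exists r, oc_levels f g k ->
    forall a b, level_hit f g a b k <-> r \in `]a, b].
  have [/level_hit_oc[r rP]|] := pselect (oc_levels f g k); first by exists r.
  by exists 0.
exists N, (r \o e); split=> [a b ab|a b].
  apply: (finite_set_reindex (C := [set k | r k \in `[a, b]]) eb).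
  (* Points of the closed segment [a,b] lie in (a - 1,b], so the finiteness of the levels hit by
     [a - 1,b] bounds them. *)
  apply: sub_finite_set (finite_level_hit intf intg (a - 1) b) => k [Dk] /=.
  by rewrite in_itv/= => /andP[ar rb]; apply/(rP k Dk); rewrite in_itv/= rb andbT; lra.
rewrite (reindex_fsbig _ _ _ _ eb); apply: eq_fsbigr => n; rewrite inE => Nn.
congr (nat_of_bool _)%:R; rewrite -[LHS]asboolb; apply: asbool_equiv_eq.
by apply: iff_sym; apply: rP; case: eb => eND _ _; exact: eND.
Qed.

Lemma co_levels_sum : exists N (s : nat -> R), locally_finite_points N s /\
  forall a b, co_sum N s a b = hit_sum (co_levels f g) a b.
Proof.
have [N [e eb]] := index_set_enumeration (co_levels f g).
have /choice[s sP] k : exists s, co_levels f g k ->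
    forall a b, level_hit f g a b k <-> s \in `[a, b[.
  have [/level_hit_co[s sP]|] := pselect (co_levels f g k); first by exists s.
  by exists 0.
exists N, (s \o e); split=> [a b ab|a b].
  apply: (finite_set_reindex (C := [set k | s k \in `[a, b]]) eb).
  (* Likewise [a,b] is included in [a,b + 1). *)
  apply: sub_finite_set (finite_level_hit intf intg a (b + 1)) => k [Dk] /=.
  by rewrite in_itv/= => /andP[as_ sb]; apply/(sP k Dk); rewrite in_itv/= as_/=; lra.
rewrite (reindex_fsbig _ _ _ _ eb); apply: eq_fsbigr => n; rewrite inE => Nn.
congr (nat_of_bool _)%:R; rewrite -[LHS]asboolb; apply: asbool_equiv_eq.
by apply: iff_sym; apply: sP; case: eb => eND _ _; exact: eND.
Qed.

Lemma itv_level_ext_itv k : itv_levels f g k ->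
  exists (cl cr : bool) (p q : \bar R), itv_endpoints p q /\
    ext_itv cl cr p q = level g k `\` level f k.
Proof.
move=> neq.
have [|cl [cr [p [q [end_pq E]]]]] :=
  interval_ext_itv (is_interval_upset_diff (upset_level (k := k) homof)
                                           (upset_level (k := k) homog)).
  apply/set0P/eqP => VU0; apply: neq; apply/seteqP.
  by split; [exact: sub_level|rewrite -setD_eq0].
by exists cl, cr, p, q.
Qed.

Lemma integer_monotone_necessity :
  exists (N1 N2 N3 : option nat) (cl cr : nat -> bool)
         (p q : nat -> \bar R) (r s : nat -> R),
    (forall n, index_set N1 n -> itv_endpoints (p n) (q n)) /\
    locally_finite_itvs N1 (fun n => ext_itv (cl n) (cr n) (p n) (q n)) /\
    locally_finite_points N2 r /\ locally_finite_points N3 s /\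
    forall a b : R, a <= b -> g b - f a =
      hitting_sum N1 (fun n => ext_itv (cl n) (cr n) (p n) (q n)) a b
      + oc_sum N2 r a b + co_sum N3 s a b.
Proof.
(* Types and endpoints are chosen for all integers at once, with {0} as a dummy interval outside
   [itv_levels]. *)
have /choice[j jP] k : exists j : bool * bool * (\bar R * \bar R),
    itv_levels f g k -> itv_endpoints j.2.1 j.2.2 /\
      ext_itv j.1.1 j.1.2 j.2.1 j.2.2 = level g k `\` level f k.
  have [Dk|] := pselect (itv_levels f g k); last by exists (true, true, (0, 0))%E.
  by have [cl [cr [p [q pqP]]]] := itv_level_ext_itv Dk; exists (cl, cr, (p, q)).
have [N1 [e [De fine sume]]] := itv_levels_hitting_sum (fun k Dk => (jP k Dk).2).
have [N2 [r [finr sumr]]] := oc_levels_sum.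
have [N3 [s [fins sums]]] := co_levels_sum.
exists N1, N2, N3, (fun n => (j (e n)).1.1), (fun n => (j (e n)).1.2),
  (fun n => (j (e n)).2.1), (fun n => (j (e n)).2.2), r, s.
split=> [n /De/jP[]//|]; split=> //; split=> //; split=> // a b ab.
by rewrite sume// sumr sums; exact: level_sum.
Qed.

Lemma integer_monotone_continuous_necessity :
  left_continuous_fun f -> right_continuous_fun g ->
  exists (N : option nat) (p q : nat -> \bar R),
    (forall n, index_set N n -> itv_endpoints (p n) (q n)) /\
    locally_finite_itvs N (fun n => ext_itv true true (p n) (q n)) /\
    forall a b : R, a <= b -> g b - f a =
      hitting_sum N (fun n => ext_itv true true (p n) (q n)) a b.
Proof.
move=> fleft gright.
have /choice[j jP] k : exists j : \bar R * \bar R,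
    itv_levels f g k -> itv_endpoints j.1 j.2 /\
      ext_itv true true j.1 j.2 = level g k `\` level f k.
  have [Dk|] := pselect (itv_levels f g k); last by exists (0, 0)%E.
  have [cl [cr [p [q [[pq endpq] E]]]]] := itv_level_ext_itv Dk.
  (* One-sided continuity makes the difference of the level sets closed, so its finite endpoints may
     be declared closed without changing the set. *)
  exists (p, q) => _; split=> //=; rewrite -E; apply/esym/closed_ext_itvE => //.
  rewrite E setDE; apply: closedI; first exact: closed_level.
  by apply: open_closedC; exact: open_level.
have [N [e [De fine sume]]] := itv_levels_hitting_sum (fun k Dk => (jP k Dk).2).
exists N, (fun n => (j (e n)).1), (fun n => (j (e n)).2).
split=> [n /De/jP[]//|]; split=> // a b ab.
rewrite sume// (level_sum intf intg homof homog fg ab).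
(* One-sided continuity leaves no level of the two point kinds, so their sums vanish. *)
rewrite [X in _ + X + _]fsbig1 ?[X in _ + _ + X]fsbig1 ?addr0//.
- by move=> k [_ [w /(right_continuous_level intg gright)]].
- move=> k [fgE [w gE]].
  by have := left_continuous_level intf fleft (etrans fgE gE).
Qed.

End levels_reindexing.

Theorem theorem4p1 (R : realType) :
  (forall phi : set R -> R, valuation phi ->
    (exists! fg : (R -> R) * (R -> R),
        fg.1 0 = 0 /\ represents fg.1 fg.2 phi) /\
    (forall f g : R -> R, f 0 = 0 -> represents f g phi ->
      (* (i) *)
      (integer_valued phi <->
         (forall x, f x \is a Num.int) /\ (forall x, g x \is a Num.int)) /\
      (* (ii) *)
      (monotone_valuation phi <->
         {homo f : x y / x <= y} /\ {homo g : x y / x <= y} /\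
         (forall x, f x <= g x)) /\
      (* (iii) *)
      (sigma_continuous phi <->
         left_continuous_fun f /\ right_continuous_fun g)) /\
    (* (iv) *)
    (integer_valued phi /\ monotone_valuation phi <->
       exists (N1 N2 N3 : option nat) (cl cr : nat -> bool)
              (p q : nat -> \bar R) (r s : nat -> R),
         (forall n, index_set N1 n -> itv_endpoints (p n) (q n)) /\
         locally_finite_itvs N1
           (fun n => ext_itv (cl n) (cr n) (p n) (q n)) /\
         locally_finite_points N2 r /\
         locally_finite_points N3 s /\
         forall a b : R, a <= b ->
           phi `[a, b]%classic =
             hitting_sum N1 (fun n => ext_itv (cl n) (cr n) (p n) (q n)) a b
             + oc_sum N2 r a b + co_sum N3 s a b) /\
    (* (v) *)
    (integer_valued phi /\ monotone_valuation phi /\ sigma_continuous phi <->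
       exists (N : option nat) (p q : nat -> \bar R),
         (forall n, index_set N n -> itv_endpoints (p n) (q n)) /\
         locally_finite_itvs N (fun n => ext_itv true true (p n) (q n)) /\
         forall a b : R, a <= b ->
           phi `[a, b]%classic =
             hitting_sum N (fun n => ext_itv true true (p n) (q n)) a b)) /\
  (* converse *)
  (forall f g : R -> R, f 0 = 0 ->
    (exists phi : set R -> R, phi set0 = 0 /\ represents f g phi) /\
    (forall phi : set R -> R,
       phi set0 = 0 -> represents f g phi -> valuation phi)).
Proof.
split=> [phi val|f g f0]; last first.
  split; first exact: representation_realizable.
  by move=> phi; exact: represents_valuation.
have phi0 : phi set0 = 0 by case: val.
have [f [g [f0 repr]]] := representation_exists val.
split; [|split; [|split]].
- exists (f, g); split=> // -[f' g'] [f'0 repr'].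
  by have [-> ->] := representation_unique f0 f'0 repr repr'.
- move=> f' g' f'0 repr'; split; first exact: integer_valuedP.
  by split; [exact: monotone_valuationP|exact: sigma_continuousP].
- split=> [[/(integer_valuedP phi0 f0 repr)[intf intg]]|].
    move=> /(monotone_valuationP phi0 repr)[homof [homog fg]].
    have [N1 [N2 [N3 [cl [cr [p [q [r [s [pqP [finJ [finr [fins phiE]]]]]]]]]]]]] :=
      integer_monotone_necessity intf intg homof homog fg.
    exists N1, N2, N3, cl, cr, p, q, r, s.
    split=> //; split=> //; split=> //; split=> // a b ab.
    by rewrite repr//; exact: phiE.
  move=> [N1 [N2 [N3 [cl [cr [p [q [r [s [_ [finJ [finr [fins phiE]]]]]]]]]]]]].
  have fin_repr : finite_sum_representation phi.
    by exists N1, N2, N3, (fun n => ext_itv (cl n) (cr n) (p n) (q n)), r, s.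
  by split; [exact: finite_sum_int|exact: finite_sum_monotone].
- split=> [[/(integer_valuedP phi0 f0 repr)[intf intg]]|].
    move=> [/(monotone_valuationP phi0 repr)[homof [homog fg]]].
    move=> /(sigma_continuousP phi0 repr)[fleft gright].
    have [N [p [q [pqP [finJ phiE]]]]] :=
      integer_monotone_continuous_necessity intf intg homof homog fg fleft gright.
    exists N, p, q; split=> //; split=> // a b ab.
    by rewrite repr//; exact: phiE.
  move=> [N [p [q [pqP [finJ phiE]]]]].
  have fin_repr : finite_sum_representation phi.
    (* A sum as in (v) is one as in (iv) with two empty families of points. *)
    exists N, (Some 0%N), (Some 0%N), (fun n => ext_itv true true (p n) (q n)),
      (fun=> 0), (fun=> 0); split=> //.
    + by move=> a b ab; rewrite (_ : [set _ | _] = set0)//; apply/seteqP; split=> n [].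
    + by move=> a b ab; rewrite (_ : [set _ | _] = set0)//; apply/seteqP; split=> n [].
    + move=> a b ab; rewrite /oc_sum /co_sum /= II0 !fsbig_set0 !addr0.
      exact: phiE.
  split; [exact: finite_sum_int|split; [exact: finite_sum_monotone|]].
  apply: (@hitting_sum_sigma_continuous _ _ N
    (fun n => ext_itv true true (p n) (q n))) => // n /pqP[pq _].
  exact: closed_ext_itv.
Qed.
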